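(* Let $k$ be an algebraically closed field of characteristic $2$ and let $\bar a,\bar b,\bar c,\bar e\in k$ with $\bar\eta=\bar c\bar e\ne0$. Let the quartic curve $Q_{(\bar a,\bar b,\bar c,\bar e)}$ be endowed with the structure of an abelian group described in the context, whose neutral element is its unique singular point $(0:1:\bar b^{1/2})$. (i) The abelian group $Q_{(\bar a,\bar b,\bar c,\bar e)}$ has a unique element of order two, which is its unique smooth point $(0:1:\bar b^{1/2}+\bar e^{-1/2})$ on the line $\{\bar x=0\}$ spanned by the singular point $(0:1:\bar b^{1/2})$ and the strange point $(0:0:1)$. If $\bar e$ tends to zero (with $\bar c\ne0$) then the element of order two approaches the node of the quartic $Q_{(\bar a,\bar b,\bar c,0)}$; and if $\bar c$ tends to zero (with $\bar e\ne0$) then the element of order two becomes the unique intersection point of the line $\{\bar x=0\}$ and the integral component of $Q_{(\bar a,\bar b,0,\bar e)}$. That is, writing the element of order two as $(0:\bar e^{1/2}:1+\bar b^{1/2}\bar e^{1/2})$, its specialization at $\bar e=0$ is the node of $Q_{(\bar a,\bar b,\bar c,0)}$, and its specialization at $\bar c=0$ is the said intersection point. (ii) The elements of order four of the quartic $Q_{(\bar a,\bar b,\bar c,\bar e)}$ are precisely its two (non-ordinary) inflection points.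
   Context: $Q_{(\bar a,\bar b,\bar c,\bar e)}\subset\mathbb P^2(k)$ is the plane quartic $\bar c\bar x^4+(\bar z^2+\bar b\bar y^2+\bar a\bar b\bar x^2)(\bar e(\bar z^2+\bar b\bar y^2+\bar a\bar b\bar x^2)+(\bar y^2+\bar x\bar y+\bar a\bar x^2))=0$. When $\bar c\bar e\ne0$ it is integral with unique singular point $(0:1:\bar b^{1/2})$. When $\bar c\neq 0$, all tangents at smooth points pass through the strange point $(0:0:1)$; when moreover $\bar e=0$, the point $(0:0:1)$ is a node of the quartic. When $\bar c=0$ and $\bar e\ne0$ the quartic consists of a double line, supported on $\{\bar z=\bar b^{1/2}\bar y+\bar a^{1/2}\bar b^{1/2}\bar x\}$, and the integral component $\{\bar e(\bar z^2+\bar b\bar y^2+\bar a\bar b\bar x^2)+\bar y^2+\bar x\bar y+\bar a\bar x^2=0\}$. Group structure (for $\bar\eta=\bar c\bar e\ne0$): the cubic $E_{(\bar a,\bar\eta)}:\ \bar y^2\bar z+\bar x\bar y\bar z=\bar x^3+\bar a\bar x^2\bar z+\bar\eta\bar x\bar z^2$ is an elliptic curve with neutral element $(0:1:0)$. The bijection $Q_{(\bar a,\bar b,\bar c,\bar e)}\to E_{(\bar a,\bar\eta)}$ sending $(0:1:\bar b^{1/2})$ to $(0:1:0)$ and any other point $(\bar x:\bar y:\bar z)$ to $(\bar c\bar x^2:\bar c\bar x\bar y:\bar z^2+\bar b\bar y^2+\bar a\bar b\bar x^2)$ transports the group structure to the set of points of $Q_{(\bar a,\bar b,\bar c,\bar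 e)}$. (The same group structure is obtained from the normalization $E_{(\bar a^{1/2},\bar\eta^{1/2})}\to Q_{(\bar a,\bar b,\bar c,\bar e)}$, which is bijective and whose composite with this bijection is the Frobenius morphism.) An inflection point is a smooth point whose tangent line meets the quartic there with multiplicity at least $3$; it is non-ordinary if the multiplicity is $4$. *)

(* Defs.v *)
From HB Require Import structures.
From mathcomp Require Import all_boot all_order all_algebra.
From mathcomp Require Export mpoly.
From mathcomp Require Import ring.

Set Implicit Arguments.
Unset Strict Implicit.
Unset Printing Implicit Defensive.
Import GRing.Theory.
Local Open Scope ring_scope.

(* The square root is unique in characteristic 2. *)
Lemma sqrt_exists (k : closedFieldType) (x : k) : exists y : k, y ^+ 2 == x.
Proof.
have [y Hy] := @solve_monicpoly k 2 (nth 0 [:: x]) isT.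
by exists y; rewrite Hy !big_ord_recl big_ord0 /= mulr1 mul0r !addr0.
Qed.
Definition sqrt (k : closedFieldType) (x : k) : k := xchoose (sqrt_exists x).

Lemma sqrtK (k : closedFieldType) (x : k) : sqrt x ^+ 2 = x.
Proof. exact/eqP/(xchooseP (sqrt_exists x)). Qed.

Section ProjectivePlane.
Variable k : fieldType.

(* The point (x : y : z) is the line spanned by (x, y, z) in k^3; it is the
   zero subspace, hence not a point of the plane, if x = y = z = 0. *)
Definition vec3 (x y z : k) : 'rV[k]_3 := \row_(i < 3) [:: x; y; z]`_i.
Definition pt (x y z : k) : {vspace 'rV[k]_3} := <[vec3 x y z]>%VS.

(* vpick chooses a representative; this and the notions below are meant for
   forms F, for which the choice is irrelevant. *)
Definition on_curve (F : {mpoly k[3]}) (U : {vspace 'rV[k]_3}) : bool :=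
  (\dim U == 1%N) && (F.@[(vpick U) 0] == 0).
Definition curve (F : {mpoly k[3]}) := {U : {vspace 'rV[k]_3} | on_curve F U}.

Variable F : {mpoly k[3]}.
Implicit Types (P : curve F) (p u : 'rV[k]_3).

Definition rep P : 'rV[k]_3 := vpick (val P).

Definition singular P : bool := [forall i, (F^`M(i)).@[(rep P) 0] == 0].

Definition on_tangent P u : bool :=
  \sum_i (F^`M(i)).@[(rep P) 0] * u 0 i == 0.

(* F(p + T u), a polynomial in T. *)
Definition restrict p u : {poly k} :=
  (map_mpoly polyC F).@[fun i => (p 0 i)%:P + u 0 i *: 'X].

Definition tangent_mult_ge P (m : nat) : Prop :=
  forall u, u \notin val P -> on_tangent P u -> 'X^m %| restrict (rep P) u.

Definition inflection P : Prop := ~~ singular P /\ tangent_mult_ge P 3.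
Definition non_ordinary_inflection P : Prop :=
  [/\ inflection P, tangent_mult_ge P 4 & ~ tangent_mult_ge P 5].

(* Ordinary double point: F has multiplicity 2 at P, and its leading form there
   is the product of the equations of two distinct lines through P, here given
   by the columns of L. *)
Definition node P : Prop :=
  exists L : 'M[k]_(3, 2),
    [/\ \rank L = 2%N, rep P *m L = 0 &
        forall u, 'X^3 %| restrict (rep P) u
                          - ((u *m L) 0 0 * (u *m L) 0 1) *: 'X^2].

End ProjectivePlane.

Definition has_order (T : Type) (zero : T) (add : T -> T -> T) (P : T)
    (n : nat) : Prop :=
  [/\ (0 < n)%N, iter n (add P) zero = zero &
      forall m, (0 < m < n)%N -> iter m (add P) zero <> zero].

Section Curves.
Variable k : fieldType.
Let x : {mpoly k[3]} := 'X_0.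
Let y : {mpoly k[3]} := 'X_1.
Let z : {mpoly k[3]} := 'X_2.

Definition cubic (a eta : k) : {mpoly k[3]} :=
  y ^+ 2 * z + x * y * z - (x ^+ 3 + a *: x ^+ 2 * z + eta *: x * z ^+ 2).

Definition wform (a b : k) : {mpoly k[3]} :=
  z ^+ 2 + b *: y ^+ 2 + (a * b) *: x ^+ 2.

(* The integral component when c = 0 and e != 0. *)
Definition conic (a b e : k) : {mpoly k[3]} :=
  e *: wform a b + (y ^+ 2 + x * y + a *: x ^+ 2).

Definition quartic (a b c e : k) : {mpoly k[3]} :=
  c *: x ^+ 4 + wform a b * conic a b e.


Lemma cubicE (a eta : k) (v : 'I_3 -> k) : (cubic a eta).@[v] =
  v 1 ^+ 2 * v 2 + v 0 * v 1 * v 2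
  - (v 0 ^+ 3 + a * v 0 ^+ 2 * v 2 + eta * v 0 * v 2 ^+ 2).
Proof.
by rewrite /cubic !(mevalD, mevalN, mevalM, mevalZ, rmorphXn) /= !mevalXU.
Qed.

Lemma wformE (a b : k) (v : 'I_3 -> k) :
  (wform a b).@[v] = v 2 ^+ 2 + b * v 1 ^+ 2 + a * b * v 0 ^+ 2.
Proof.
by rewrite /wform !(mevalD, mevalM, mevalZ, rmorphXn) /= !mevalXU.
Qed.

Lemma quarticE (a b c e : k) (v : 'I_3 -> k) : (quartic a b c e).@[v] =
  let w := v 2 ^+ 2 + b * v 1 ^+ 2 + a * b * v 0 ^+ 2 in
  c * v 0 ^+ 4 + w * (e * w + (v 1 ^+ 2 + v 0 * v 1 + a * v 0 ^+ 2)).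
Proof.
rewrite /quartic /conic !(mevalD, mevalM, mevalZ, wformE, rmorphXn) /=.
by rewrite !mevalXU.
Qed.

Lemma vec3E (p q r : k) : (vec3 p q r 0 0 = p) * (vec3 p q r 0 1 = q)
  * (vec3 p q r 0 2 = r).
Proof. by rewrite !mxE. Qed.

Lemma vec3K (v : 'rV[k]_3) : vec3 (v 0 0) (v 0 1) (v 0 2) = v.
Proof.
apply/rowP => i; rewrite mxE; case: i => [[|[|[|//]]] Hi] /=; congr (v _ _);
  exact/val_inj.
Qed.

Lemma vec3_eq0 (p q r : k) :
  (vec3 p q r == 0) = [&& p == 0, q == 0 & r == 0].
Proof.
apply/eqP/and3P => [H|[/eqP-> /eqP-> /eqP->]].
  have := vec3E p q r; rewrite H !mxE => -[[<- <-] <-].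
  by rewrite eqxx.
by apply/rowP => i; rewrite !mxE; case: i => [[|[|[|//]]] Hi].
Qed.

Lemma scale_vec3 (t p q r : k) : t *: vec3 p q r = vec3 (t * p) (t * q) (t * r).
Proof. by apply/rowP => i; rewrite !mxE; case: i => [[|[|[|//]]] Hi]. Qed.

Lemma ptZ (t p q r : k) : t != 0 -> pt (t * p) (t * q) (t * r) = pt p q r.
Proof.
move=> t0; apply/vspaceP => v; apply/vlineP/vlineP => -[s ->].
  by exists (s * t); rewrite -scale_vec3 scalerA.
by exists (s / t); rewrite -scale_vec3 scalerA divfK.
Qed.

Lemma pt_inj (p q r p' q' r' : k) : pt p q r = pt p' q' r' ->
  exists t, [/\ p = t * p', q = t * q' & r = t * r'].
Proof.
move=> H; have : vec3 p q r \in pt p' q' r' by rewrite -H memv_line.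
case/vlineP => t Ht; exists t.
have := vec3E p q r; rewrite {1 2 3}Ht scale_vec3 !vec3E => -[[<- <-] <-].
by [].
Qed.

Lemma vpick_pt (p q r : k) : ~~ [&& p == 0, q == 0 & r == 0] ->
  exists2 t, t != 0 & vpick (pt p q r) = vec3 (t * p) (t * q) (t * r).
Proof.
rewrite -vec3_eq0 => v0.
have /vlineP[t Ht] := memv_pick (pt p q r).
exists t; last by rewrite Ht scale_vec3.
apply: contra v0 => /eqP t0; move/eqP: Ht; rewrite t0 scale0r vpick0.
by rewrite -dimv_eq0 dim_vline; case: (vec3 _ _ _ == 0).
Qed.

Lemma curve_pt (F : {mpoly k[3]}) (P : curve F) :
  val P = pt (rep P 0 0) (rep P 0 1) (rep P 0 2).
Proof.
have /andP[/eqP d1 _] := valP P; rewrite /pt vec3K.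
apply/esym/eqP; rewrite eqEdim -memvE memv_pick dim_vline d1 /rep vpick0 -dimv_eq0 d1.
by [].
Qed.

Lemma rep_neq0 (F : {mpoly k[3]}) (P : curve F) :
  ~~ [&& rep P 0 0 == 0, rep P 0 1 == 0 & rep P 0 2 == 0].
Proof.
have /andP[/eqP d1 _] := valP P.
by rewrite -vec3_eq0 vec3K /rep vpick0 -dimv_eq0 d1.
Qed.

Lemma repP (F : {mpoly k[3]}) (P : curve F) : F.@[(rep P) 0] = 0.
Proof. by have /andP[_ /eqP] := valP P. Qed.

Lemma on_cubic_pt (a eta p q r : k) : ~~ [&& p == 0, q == 0 & r == 0] ->
  (cubic a eta).@[(vec3 p q r) 0] = 0 -> on_curve (cubic a eta) (pt p q r).
Proof.
move=> v0; rewrite cubicE !vec3E => H; apply/andP; split.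
  by rewrite dim_vline vec3_eq0 v0.
have [t _ ->] := vpick_pt v0.
rewrite cubicE !vec3E; apply/eqP; transitivity (t ^+ 3 * 0); last exact: mulr0.
by rewrite -H; ring.
Qed.

Lemma on_quartic_pt (a b c e p q r : k) : ~~ [&& p == 0, q == 0 & r == 0] ->
  (quartic a b c e).@[(vec3 p q r) 0] = 0 ->
  on_curve (quartic a b c e) (pt p q r).
Proof.
move=> v0; rewrite quarticE !vec3E => H; apply/andP; split.
  by rewrite dim_vline vec3_eq0 v0.
have [t _ ->] := vpick_pt v0.
rewrite quarticE !vec3E; apply/eqP; transitivity (t ^+ 4 * 0); last exact: mulr0.
by rewrite -H /=; ring.
Qed.

(* The chord-tangent law on y^2 + xy = x^3 + a x^2 + eta x; the points with
   z != 0 are read in the affine coordinates x/z, y/z, and (0 : 1 : 0) is the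
   only point of the cubic with z = 0. *)
Definition cubic_add_pt (a eta : k) (U V : {vspace 'rV[k]_3}) :
    {vspace 'rV[k]_3} :=
  let u := vpick U in
  let v := vpick V in
  if u 0 2 == 0 then V else if v 0 2 == 0 then U else
  let x1 := u 0 0 / u 0 2 in
  let y1 := u 0 1 / u 0 2 in
  let x2 := v 0 0 / v 0 2 in
  let y2 := v 0 1 / v 0 2 in
  if (x1 == x2) && (y2 == - y1 - x1) then pt 0 1 0 else
  let l := if x1 == x2
           then (3 * x1 ^+ 2 + 2 * a * x1 + eta - y1) / (2 * y1 + x1)
           else (y2 - y1) / (x2 - x1) in
  let x3 := l ^+ 2 + l - a - x1 - x2 in
  pt x3 (- (y1 + l * (x3 - x1)) - x3) 1.

Lemma cubic_zero_on (a eta : k) : on_curve (cubic a eta) (pt 0 1 0).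
Proof.
apply: on_cubic_pt; first by rewrite oner_eq0 andbF.
by rewrite cubicE !vec3E; ring.
Qed.

Lemma cubic_affine (a eta : k) (P : curve (cubic a eta)) : rep P 0 2 != 0 ->
  let p := rep P 0 0 / rep P 0 2 in
  let q := rep P 0 1 / rep P 0 2 in
  q ^+ 2 + p * q = p ^+ 3 + a * p ^+ 2 + eta * p.
Proof.
move=> z0 p q; have := repP P; rewrite cubicE /p /q.
move: (rep P 0 0) (rep P 0 1) (rep P 0 2) z0 => {p q} p q r r0 H.
apply/eqP; rewrite -subr_eq0; apply/eqP.
transitivity (0 / r ^+ 3); last by rewrite mul0r.
by rewrite -H; field.
Qed.

Lemma cubic_add_on (a eta : k) (P Q : curve (cubic a eta)) :
  on_curve (cubic a eta) (cubic_add_pt a eta (val P) (val Q)).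
Proof.
rewrite /cubic_add_pt -/(rep P) -/(rep Q).
case: eqP => [_|/eqP zP]; first exact: (valP Q).
case: eqP => [_|/eqP zQ]; first exact: (valP P).
have := cubic_affine zP; have := cubic_affine zQ; cbv zeta.
move: (rep P 0 0 / rep P 0 2) (rep P 0 1 / rep P 0 2) => x1 y1.
move: (rep Q 0 0 / rep Q 0 2) (rep Q 0 1 / rep Q 0 2) => x2 y2 H2 H1.
case: ifP => [_|neg]; first exact: cubic_zero_on.
have on_l l : let x3 := l ^+ 2 + l - a - x1 - x2 in
    let y3 := - (y1 + l * (x3 - x1)) - x3 in
    y3 ^+ 2 + x3 * y3 - (x3 ^+ 3 + a * x3 ^+ 2 + eta * x3) = 0 ->
    on_curve (cubic a eta) (pt x3 y3 1).
  move=> x3 y3 H; apply: on_cubic_pt; first by rewrite oner_eq0 !andbF.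
  by rewrite cubicE !vec3E -[RHS]H; ring.
apply: on_l; have [x12|neq] := eqVneq x1 x2.
  rewrite -{}x12 eqxx /= in H2 neg *; move/negbT: neg => neg.
  have y12 : y2 = y1.
    apply/eqP; rewrite -subr_eq0.
    have : (y2 - y1) * (y2 - (- y1 - x1)) == 0.
      apply/eqP; transitivity ((y2 ^+ 2 + x1 * y2) - (y1 ^+ 2 + x1 * y1)).
        by ring.
      by rewrite H1 H2 subrr.
    by rewrite mulf_eq0 [X in _ || X]subr_eq0 (negPf neg) orbF.
  have d0 : 2 * y1 + x1 != 0.
    apply: contra neg => /eqP d; rewrite y12 -subr_eq0; apply/eqP.
    by rewrite -[RHS]d; ring.
  have := divfK d0 (3 * x1 ^+ 2 + 2 * a * x1 + eta - y1).
  move: (_ / _) => l Hl; set x3 := l ^+ 2 + l - a - x1 - x1.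
  transitivity ((y1 ^+ 2 + x1 * y1 - (x1 ^+ 3 + a * x1 ^+ 2 + eta * x1))
    + (x3 - x1) * (l * (2 * y1 + x1)
         - (3 * x1 ^+ 2 + 2 * a * x1 + eta - y1))).
    by rewrite /x3; ring.
  by rewrite H1 Hl !subrr mulr0 addr0.
have d0 : x2 - x1 != 0 by rewrite subr_eq0 eq_sym.
have := divfK d0 (y2 - y1); move: (_ / _) => l Hl.
have y2E : y2 = y1 + l * (x2 - x1) by rewrite Hl; ring.
set x3 := l ^+ 2 + l - a - x1 - x2.
apply: (mulfI d0); rewrite mulr0.
transitivity
  ((x3 - x1) * ((y2 ^+ 2 + x2 * y2) - (x2 ^+ 3 + a * x2 ^+ 2 + eta * x2))
   - (x3 - x2) * (y1 ^+ 2 + x1 * y1 - (x1 ^+ 3 + a * x1 ^+ 2 + eta * x1))).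
  by rewrite y2E /x3; ring.
by rewrite H1 H2 !subrr !mulr0 subrr.
Qed.

Definition cubic_zero (a eta : k) : curve (cubic a eta) :=
  Sub (pt 0 1 0) (cubic_zero_on a eta).
Definition cubic_add (a eta : k) (P Q : curve (cubic a eta)) :
    curve (cubic a eta) :=
  Sub (cubic_add_pt a eta (val P) (val Q)) (cubic_add_on P Q).

End Curves.

Section Transport.
Variables (k : closedFieldType) (a b c e : k).

Definition to_cubic (P : curve (quartic a b c e)) : curve (cubic a (c * e)) :=
  let x := rep P 0 0 in let y := rep P 0 1 in let z := rep P 0 2 in
  if val P == pt 0 1 (sqrt b) then cubic_zero a (c * e)
  else insubd (cubic_zero a (c * e))
    (pt (c * x ^+ 2) (c * x * y) (z ^+ 2 + b * y ^+ 2 + a * b * x ^+ 2)).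

Hypotheses (char2 : 2%N \in [pchar k]) (ce_neq0 : c * e != 0).

Let two0 : 2 = 0 :> k. Proof. exact: pcharf0 char2. Qed.

Let c_neq0 : c != 0. Proof. by apply: contraNneq ce_neq0 => ->; rewrite mul0r. Qed.

Let sqr_inj (s t : k) : s ^+ 2 = t ^+ 2 -> s = t.
Proof.
move=> H; apply/eqP; rewrite -subr_eq0 -sqrf_eq0; apply/eqP.
transitivity (s ^+ 2 - t ^+ 2 + 2 * (t ^+ 2 - s * t)); first by ring.
by rewrite H subrr two0 mul0r addr0.
Qed.

Let wf (x y z : k) := z ^+ 2 + b * y ^+ 2 + a * b * x ^+ 2.

Let wf0 (x y z : k) : ~~ [&& x == 0, y == 0 & z == 0] -> x = 0 ->
  wf x y z = 0 -> pt x y z = pt 0 1 (sqrt b).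
Proof.
move=> v0 x0; rewrite x0 eqxx /= in v0 *; move=> W.
have H : z ^+ 2 + b * y ^+ 2 = 0 by rewrite -[RHS]W /wf; ring.
have zE : z = y * sqrt b.
  apply: sqr_inj; rewrite exprMn sqrtK.
  transitivity (z ^+ 2 + b * y ^+ 2 - 2 * (b * y ^+ 2) + b * y ^+ 2).
    by ring.
  by rewrite H two0; ring.
have y0 : y != 0 by apply: contra v0 => /eqP y0; rewrite zE y0 mul0r eqxx.
by rewrite -[RHS](ptZ _ _ _ y0) mulr0 mulr1 zE.
Qed.

Let repQ (P : curve (quartic a b c e)) :
  let x := rep P 0 0 in let y := rep P 0 1 in let z := rep P 0 2 in
  c * x ^+ 4 + wf x y z * (e * wf x y z + (y ^+ 2 + x * y + a * x ^+ 2)) = 0.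
Proof. by have := repP P; rewrite quarticE. Qed.

Let wf_neq0 (P : curve (quartic a b c e)) : val P != pt 0 1 (sqrt b) ->
  wf (rep P 0 0) (rep P 0 1) (rep P 0 2) != 0.
Proof.
apply: contra => /eqP w0; apply/eqP; rewrite curve_pt; apply: wf0 => //.
  exact: rep_neq0.
have := repQ P; rewrite /= w0 mul0r addr0 => /eqP.
by rewrite mulf_eq0 (negPf c_neq0) expf_eq0 => /eqP.
Qed.

Lemma to_cubic_zero (P : curve (quartic a b c e)) :
  val P = pt 0 1 (sqrt b) -> to_cubic P = cubic_zero a (c * e).
Proof. by move=> H; rewrite /to_cubic H eqxx. Qed.

Lemma to_cubicE (P : curve (quartic a b c e)) :
  let x := rep P 0 0 in let y := rep P 0 1 in let z := rep P 0 2 in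
  val P != pt 0 1 (sqrt b) ->
  val (to_cubic P) =
    pt (c * x ^+ 2) (c * x * y) (z ^+ 2 + b * y ^+ 2 + a * b * x ^+ 2).
Proof.
move=> x y z Ps; rewrite /to_cubic (negPf Ps) -/x -/y -/z val_insubd ifT //.
have w0 := wf_neq0 Ps; rewrite -/x -/y -/z /wf in w0.
apply: on_cubic_pt; first by rewrite (negPf w0) !andbF.
have := repQ P; rewrite /= cubicE !vec3E -/x -/y -/z /wf.
move: (_ + _ + a * b * _) => w H.
transitivity (c ^+ 2 * x ^+ 2 * (c * x ^+ 4 + w * (e * w + (y ^+ 2 + x * y + a * x ^+ 2)))
  - 2 * (c ^+ 3 * x ^+ 6 + a * c ^+ 2 * x ^+ 4 * w + c ^+ 2 * e * x ^+ 2 * w ^+ 2)).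
  by ring.
by rewrite H two0 mul0r mulr0 subrr.
Qed.

Lemma to_cubic_inj : injective to_cubic.
Proof.
move=> P R H.
have zeroN (T : curve (quartic a b c e)) : val T != pt 0 1 (sqrt b) ->
    to_cubic T <> cubic_zero a (c * e).
  move=> Ts /(congr1 val); rewrite to_cubicE //= => /pt_inj[t [_ _]].
  by rewrite mulr0; apply/eqP/wf_neq0.
have [Ps|Ps] := eqVneq (val P) (pt 0 1 (sqrt b)).
  have [Rs|Rs] := eqVneq (val R) (pt 0 1 (sqrt b)).
    by apply: val_inj; rewrite Ps Rs.
  by case: (zeroN _ Rs); rewrite -H to_cubic_zero.
have [Rs|Rs] := eqVneq (val R) (pt 0 1 (sqrt b)).
  by case: (zeroN _ Ps); rewrite H to_cubic_zero.
have wP := wf_neq0 Ps; have wR := wf_neq0 Rs.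
have := congr1 val H; rewrite !to_cubicE //= => PR.
apply: val_inj; rewrite (curve_pt P) (curve_pt R).
move: (repQ P) (repQ R) wP wR PR => /=.
move: (rep P 0 0) (rep P 0 1) (rep P 0 2) => x y z.
move: (rep R 0 0) (rep R 0 1) (rep R 0 2) => x' y' z' FP FR wP wR.
case/pt_inj => t [Hx Hy Hw]; rewrite -/(wf x y z) -/(wf x' y' z') in Hw.
have t0 : t != 0 by apply: contra wP => /eqP t0; rewrite Hw t0 mul0r.
have s0 : sqrt t != 0 by rewrite -sqrf_eq0 sqrtK.
have xE : x = sqrt t * x'.
  by apply: sqr_inj; rewrite exprMn sqrtK; apply: (mulfI c_neq0); rewrite Hx; ring.
have yE : y = sqrt t * y'.
  have [x'0|x'0] := eqVneq x' 0; last first.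
    have x0 : x != 0 by rewrite xE mulf_neq0.
    apply: (mulfI (mulf_neq0 c_neq0 x0)); rewrite Hy {1}xE -{1}(sqrtK t); ring.
  have x0 : x = 0 by rewrite xE x'0 mulr0.
  have aux (v w : k) : w != 0 ->
      c * 0 ^+ 4 + w * (e * w + (v ^+ 2 + 0 * v + a * 0 ^+ 2)) = 0 ->
      v ^+ 2 = e * w.
    move=> w0 Hv; apply: (mulfI w0).
    transitivity (c * 0 ^+ 4 + w * (e * w + (v ^+ 2 + 0 * v + a * 0 ^+ 2))
                  - 2 * (e * w ^+ 2) + w * (e * w)); first by ring.
    by rewrite Hv two0; ring.
  rewrite x0 in FP wP Hw; rewrite x'0 in FR wR Hw.
  apply: sqr_inj; rewrite exprMn sqrtK (aux _ _ wP FP) (aux _ _ wR FR) Hw; ring.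
have zE : z = sqrt t * z'.
  apply: sqr_inj; rewrite exprMn sqrtK.
  transitivity (wf x y z - b * y ^+ 2 - a * b * x ^+ 2); first by rewrite /wf; ring.
  by rewrite Hw xE yE !exprMn sqrtK /wf; ring.
by rewrite xE yE zE ptZ.
Qed.

Let to_cubic_pt (x y z : k) (H : on_curve (quartic a b c e) (pt x y z)) :
  wf x y z != 0 ->
  val (to_cubic (Sub (pt x y z) H)) = pt (c * x ^+ 2) (c * x * y) (wf x y z).
Proof.
move=> w0.
have v0 : ~~ [&& x == 0, y == 0 & z == 0].
  apply: contra w0 => /and3P[/eqP-> /eqP-> /eqP->]; apply/eqP; rewrite /wf; ring.
rewrite to_cubicE; last first.
  apply: contra w0 => /eqP /pt_inj[t [-> -> ->]]; apply/eqP.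
  transitivity (2 * (t ^+ 2 * b)); last by rewrite two0 mul0r.
  by rewrite /wf exprMn sqrtK; ring.
rewrite /rep /=; have [t t0 ->] := vpick_pt v0; rewrite !vec3E.
by rewrite -[RHS](@ptZ _ (t ^+ 2)) ?expf_neq0 //; congr pt; rewrite /wf; ring.
Qed.

Lemma to_cubic_surj (R : curve (cubic a (c * e))) :
  exists P : curve (quartic a b c e), to_cubic P == R.
Proof.
have := repP R; have := rep_neq0 R; have := curve_pt R; rewrite cubicE.
move: (rep R 0 0) (rep R 0 1) (rep R 0 2) => x y z RE v0 HR.
have [z0|z0] := eqVneq z 0.
  have x0 : x = 0.
    have /eqP : x ^+ 3 = 0 by rewrite -[LHS]opprK -[RHS]oppr0 -HR z0; ring.
    by rewrite expf_eq0 => /eqP.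
  have y0 : y != 0 by move: v0; rewrite x0 z0 !eqxx andbT.
  suff H : on_curve (quartic a b c e) (pt 0 1 (sqrt b)).
    exists (Sub _ H); rewrite to_cubic_zero //; apply/eqP/val_inj => /=.
    by rewrite RE -[LHS](ptZ _ _ _ y0) mulr0 mulr1 x0 z0.
  apply: on_quartic_pt; first by rewrite oner_eq0 andbF.
  rewrite quarticE !vec3E /=.
  transitivity (2 * (b * (e * (2 * b) + 1))); last by rewrite two0 mul0r.
  by rewrite sqrtK; ring.
have [x0|x0] := eqVneq x 0.
  have y0 : y = 0.
    have : z * y ^+ 2 == 0 by rewrite -[X in _ == X]HR x0; apply/eqP; ring.
    by rewrite mulf_eq0 (negPf z0) sqrf_eq0 => /eqP.
  have w1 : wf 0 (sqrt e) (1 + sqrt b * sqrt e) = 1.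
    transitivity (1 + 2 * (sqrt b * sqrt e) + sqrt b ^+ 2 * sqrt e ^+ 2
                  + b * sqrt e ^+ 2); first by rewrite /wf; ring.
    transitivity (1 + 2 * (sqrt b * sqrt e + b * e)).
      by rewrite !sqrtK; ring.
    by rewrite two0; ring.
  suff H : on_curve (quartic a b c e) (pt 0 (sqrt e) (1 + sqrt b * sqrt e)).
    exists (Sub _ H); apply/eqP/val_inj.
    rewrite to_cubic_pt w1 ?oner_eq0 // RE x0 y0.
    rewrite -[LHS](@ptZ _ z) //; congr pt; ring.
  apply: on_quartic_pt.
    apply/negP => /and3P[_ /eqP e0 /eqP]; rewrite e0 mulr0 addr0.
    by apply/eqP; rewrite oner_eq0.
  rewrite quarticE !vec3E /= -/(wf 0 (sqrt e) (1 + sqrt b * sqrt e)) w1 sqrtK.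
  by transitivity (2 * e); [ring|rewrite two0 mul0r].
pose r := sqrt (c * x * z - b * y ^+ 2 - a * b * x ^+ 2).
have wE : wf x y r = c * x * z by rewrite /wf sqrtK; ring.
suff H : on_curve (quartic a b c e) (pt x y r).
  exists (Sub _ H); apply/eqP/val_inj.
  rewrite to_cubic_pt wE ?mulf_neq0 // RE.
  by rewrite -[RHS](@ptZ _ (c * x)) ?mulf_neq0 //; congr pt; ring.
apply: on_quartic_pt; first by rewrite (negPf x0).
rewrite quarticE !vec3E /= -/(wf x y r) wE.
transitivity (c * x * (y ^+ 2 * z + x * y * z
    - (x ^+ 3 + a * x ^+ 2 * z + c * e * x * z ^+ 2)
    + 2 * (x ^+ 3 + a * x ^+ 2 * z + c * e * x * z ^+ 2))); first by ring.
by rewrite HR two0; ring.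
Qed.

Definition of_cubic (R : curve (cubic a (c * e))) : curve (quartic a b c e) :=
  xchoose (to_cubic_surj R).

Lemma of_cubicK : cancel of_cubic to_cubic.
Proof. by move=> R; apply/eqP/(xchooseP (to_cubic_surj R)). Qed.

Lemma to_cubicK : cancel to_cubic of_cubic.
Proof. by move=> P; apply: to_cubic_inj; rewrite of_cubicK. Qed.

(* The group law on the quartic, transported along the bijection to_cubic. *)
Definition quartic_zero : curve (quartic a b c e) :=
  of_cubic (cubic_zero a (c * e)).
Definition quartic_add (P R : curve (quartic a b c e)) :
    curve (quartic a b c e) :=
  of_cubic (cubic_add (to_cubic P) (to_cubic R)).

End Transport.

Lemma quartic_c0 (k : closedFieldType) (a b e : k) : 2%N \in [pchar k] ->
  quartic a b 0 e =
  ('X_2 - sqrt b *: 'X_1 - (sqrt a * sqrt b) *: 'X_0) ^+ 2 * conic a b e.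
Proof.
move=> char2; rewrite /quartic scale0r add0r; congr (_ * _).
have two0 : 2 = 0 :> {mpoly k[3]} by rewrite -mpolyC_nat (pcharf0 char2) mpolyC0.
have := sqrtK b; have := sqrtK a; move: (sqrt a) (sqrt b) => r s <- <-.
rewrite /wform -!mul_mpolyC !(expr2 r) !(expr2 s) !mpolyCM.
move: s%:MP r%:MP => B A.
apply/esym/eqP; rewrite -subr_eq0; apply/eqP.
transitivity (2 * (A * B ^+ 2 * 'X_1 * 'X_0 - B * 'X_2 * 'X_1
                   - A * B * 'X_2 * 'X_0) : {mpoly k[3]}); first by ring.
by rewrite two0 mul0r.
Qed.

(* Homogeneous coordinates of the element of order two when c * e != 0, that
   make sense for all e. *)
Definition order_two_pt (k : closedFieldType) (b e : k) : {vspace 'rV[k]_3} :=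
  pt 0 (sqrt e) (1 + sqrt b * sqrt e).

Definition quartic_order (k : closedFieldType) (a b c e : k)
    (char2 : 2%N \in [pchar k]) (ce_neq0 : c * e != 0)
    (P : curve (quartic a b c e)) (n : nat) : Prop :=
  has_order (quartic_zero a b char2 ce_neq0) (quartic_add char2 ce_neq0) P n.

(* Main.v *)
Require Import Defs.
From mathcomp Require Import all_boot all_order all_algebra.
From mathcomp Require Import ring.
Set Implicit Arguments.
Unset Strict Implicit.
Unset Printing Implicit Defensive.
Import GRing.Theory.
Local Open Scope ring_scope.

(** Write [w = z^2 + b y^2 + a b x^2] and [q = y^2 + x y + a x^2], so that the
    quartic is [F = c x^4 + e w^2 + w q]. In characteristic two [w] is the
    square of a linear form, so that [dw = 0] and [dF = w (y dx + x dy)]. The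
    geometry can be read off the expansion ([restrict_quartic])
      [F (p + T u) = F p + w(p) l T + (w(u) q(p) + w(p) q(u)) T^2
                     + w(u) l T^3 + F(u) T^4]
    with [l = y(p) x(u) + x(p) y(u)]. If [c] and [e] are nonzero, then a point
    is singular exactly if [w = 0] there, that is, if it is [(0 : 1 : sqrt b)].
    At a smooth point the tangent is the line [l = 0] through the strange point;
    along it only the terms in [T^2] and [T^4] remain. In the direction
    [(0, 0, 1)] the first has coefficient [q(p)] and the second [e], so that the
    smooth points with [q = 0] are the inflection points, all of multiplicity
    four ([inflectionE], [tangent_mult_quartic]).

    On the side of the groups, orders are the same on the quartic and on the
    cubic ([has_order_morph]), where they can be computed with the chord-tangent
    formulas. The double of [(x, y)] has abscissa [(x^2 + eta)^2 / x^2]; hence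
    order two means [x = 0], and order four means that the double is [(0, 0)],
    that is [x^2 = eta] ([cubic_order2], [cubic_order4]). As the bijection sends
    a smooth point to the abscissa [c x^2 / w], order two on the quartic amounts
    to [x = 0], and order four to [c x^4 = e w^2], which by the equation
    [F = 0] is [q = 0] again ([quartic_order2], [quartic_order4]). The form [q]
    is the product of [y + r x] and [y + (r + 1) x] with [r^2 + r = a], and
    on each of these two lines [c x^4 = e w^2] leaves one point ([flex_cases]).

    For [e = 0] the leading forms at the singular points [(0 : 0 : 1)] and
    [(0 : 1 : sqrt b)] are proportional to [q], which has two distinct linear
    factors, and to [w], which is a square: only the first point is a node. *)

(** * Characteristic two *)

(** The term [2 * K] gathers the monomials of [l - r] with even coefficients, so
    that an identity in characteristic two follows from one in any ring. *)
Lemma eq_mod2 (R : pzRingType) (K l r : R) :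
  2 = 0 :> R -> l = r + 2 * K -> l = r.
Proof. by move=> two0 ->; rewrite two0 mul0r addr0. Qed.

Lemma two0_poly (k : fieldType) : 2 = 0 :> k -> 2 = 0 :> {poly k}.
Proof. by move=> two0; rewrite -polyC_natr two0 polyC0. Qed.

Lemma eq_addr2 (k : fieldType) (two0 : 2 = 0 :> k) (x y : k) :
  x + y = 0 <-> x = y.
Proof.
split=> [H|->]; last by apply: (eq_mod2 (K := y) two0); ring.
by apply: (eq_mod2 (K := - y) two0); rewrite -[LHS](addrK y) H; ring.
Qed.

Lemma sqr_inj2 (k : fieldType) (char2 : 2%N \in [pchar k]) (x y : k) :
  x ^+ 2 = y ^+ 2 -> x = y.
Proof. by rewrite -!(pFrobenius_autE char2); apply: fmorph_inj. Qed.

(** Squaring is additive, so that [s + t] is a root of [T^2 + T]. *)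
Lemma artin_schreier_eq (k : fieldType) (two0 : 2 = 0 :> k) (s t : k) :
  s ^+ 2 + s = t ^+ 2 + t -> s = t \/ s = t + 1.
Proof.
move/(eq_addr2 two0)=> H.
have /eqP : (s + t) * (s + (t + 1)) = 0.
  by apply: (eq_mod2 (K := s * t) two0); rewrite -H; ring.
rewrite mulf_eq0 => /orP[] /eqP /(eq_addr2 two0); first by left.
by right.
Qed.

Lemma sqrt0 (k : closedFieldType) : sqrt (0 : k) = 0.
Proof. by apply/eqP; rewrite -sqrf_eq0 sqrtK. Qed.

(** * Coordinates *)

Lemma sum_ord3 (V : nmodType) (f : 'I_3 -> V) :
  \sum_i f i = f 0 + f 1 + f 2.
Proof.
rewrite !big_ord_recr big_ord0 /= add0r.
by congr (f _ + f _ + f _); apply: val_inj.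
Qed.

Lemma forall_ord3 (p : pred 'I_3) :
  [forall i, p i] = [&& p 0, p 1 & p 2].
Proof.
apply/forallP/and3P => [H|[p0 p1 p2] [[|[|[|//]]] Hi]]; first by split.
- by rewrite (_ : Ordinal Hi = 0) //; apply: val_inj.
- by rewrite (_ : Ordinal Hi = 1) //; apply: val_inj.
- by rewrite (_ : Ordinal Hi = 2) //; apply: val_inj.
Qed.

Lemma rep_pt (k : fieldType) (F : {mpoly k[3]}) (P : curve F) (x y z : k) :
  val P = pt x y z -> exists t, [/\ t != 0, rep P 0 0 = t * x,
    rep P 0 1 = t * y & rep P 0 2 = t * z].
Proof.
move=> H; have := curve_pt P; rewrite H => /esym /pt_inj[t [x0 y0 z0]].
exists t; split=> //; apply: contra (rep_neq0 P) => /eqP t0.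
by rewrite x0 y0 z0 t0 !mul0r eqxx.
Qed.

Lemma pt_affine_neq (k : fieldType) (x y : k) : pt x y 1 <> pt 0 1 0.
Proof.
by case/pt_inj=> t [_ _ /eqP]; rewrite mulr0; apply/negP/oner_neq0.
Qed.

Definition wval (k : fieldType) (a b : k) (v : 'rV[k]_3) : k :=
  v 0 2 ^+ 2 + b * v 0 1 ^+ 2 + a * b * v 0 0 ^+ 2.
Definition qval (k : fieldType) (a : k) (v : 'rV[k]_3) : k :=
  v 0 1 ^+ 2 + v 0 0 * v 0 1 + a * v 0 0 ^+ 2.

Lemma quartic_val (k : fieldType) (a b c e : k) (v : 'rV[k]_3) :
  (quartic a b c e).@[v 0] =
  c * v 0 0 ^+ 4 + wval a b v * (e * wval a b v + qval a v).
Proof. by rewrite quarticE. Qed.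

Lemma rep_quartic (k : fieldType) (a b c e : k)
    (P : curve (quartic a b c e)) :
  c * rep P 0 0 ^+ 4
  + wval a b (rep P) * (e * wval a b (rep P) + qval a (rep P)) = 0.
Proof. by rewrite -quartic_val repP. Qed.

(** * Taylor expansion *)

Lemma mderivXU (R : nzRingType) n (i j : 'I_n) :
  ('X_j : {mpoly R[n]})^`M(i) = (j == i)%:R.
Proof.
rewrite mderivX mnm1E; case: eqP => [->|_]; last by rewrite scale0r.
by rewrite -[X in (X - _)%MM]addm0 addmC addmK mpolyX0 scale1r.
Qed.

(** The differential of [w] is zero and that of [q] is [y dx + x dy]. *)
Lemma quartic_partials (k : fieldType) (two0 : 2 = 0 :> k) (a b c e : k)
    (v : 'rV[k]_3) :
  [/\ ((quartic a b c e)^`M(0)).@[v 0] = wval a b v * v 0 1,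
      ((quartic a b c e)^`M(1)).@[v 0] = wval a b v * v 0 0
    & ((quartic a b c e)^`M(2)).@[v 0] = 0].
Proof.
pose w := wval a b v; pose q := qval a v.
split; rewrite /quartic /conic /wform !exprS !expr0 !mulr1;
  rewrite !(mderivD, mderivM, mderivZ, mderivXU) /=;
  rewrite !(mevalD, mevalM, mevalZ, mevalXU, mevalC, meval1, rmorph0, rmorph1).
- apply: (eq_mod2 (K := 2 * c * v 0 0 ^+ 3 + a * b * v 0 0 * (e * w + q)
    + w * (e * a * b * v 0 0 + a * v 0 0)) two0).
  by rewrite /w /q /wval /qval; ring.
- apply: (eq_mod2 (K := b * v 0 1 * (e * w + q)
    + w * (e * b * v 0 1 + v 0 1)) two0).
  by rewrite /w /q /wval /qval; ring.
- apply: (eq_mod2 (K := v 0 2 * (e * w + q) + w * e * v 0 2) two0).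
  by rewrite /w /q /wval /qval; ring.
Qed.

(** Restricting to a parametrized line is a ring morphism, so that it can be
    computed on the equation of the quartic. *)
Lemma quartic_rmorph (k : fieldType) (S : comNzRingType) (h : k -> S)
    (g : {rmorphism {mpoly k[3]} -> S})
    (gZ : forall s F, g (s *: F) = h s * g F) (a b c e : k) :
  let w := g 'X_2 ^+ 2 + h b * g 'X_1 ^+ 2 + h (a * b) * g 'X_0 ^+ 2 in
  g (quartic a b c e) = h c * g 'X_0 ^+ 4
    + w * (h e * w + (g 'X_1 ^+ 2 + g 'X_0 * g 'X_1 + h a * g 'X_0 ^+ 2)).
Proof.
rewrite /quartic /conic /wform.
by rewrite !(rmorphD g, gZ, rmorphXn g, rmorphM g).
Qed.

(** The forms [w] and [q] have polar forms [0] and [l], so that [w (p + T u)] is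
    [w(p) + T^2 w(u)] and [q (p + T u)] is [q(p) + T l + T^2 q(u)]; what remains
    after substitution is grouped with the help of the values of [F]. *)
Lemma restrict_quartic (k : fieldType) (two0 : 2 = 0 :> k) (a b c e : k)
    (p u : 'rV[k]_3) :
  let l := p 0 1 * u 0 0 + p 0 0 * u 0 1 in
  restrict (quartic a b c e) p u =
    ((quartic a b c e).@[p 0])%:P + (wval a b p * l)%:P * 'X
    + (wval a b u * qval a p + wval a b p * qval a u)%:P * 'X^2
    + (wval a b u * l)%:P * 'X^3 + ((quartic a b c e).@[u 0])%:P * 'X^4.
Proof.
move=> l; rewrite /restrict.
pose f i : {poly k} := (p 0 i)%:P + u 0 i *: 'X.
pose g : {rmorphism {mpoly k[3]} -> {poly k}} := meval f \o map_mpoly polyC.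
have gZ s F : g (s *: F) = s%:P * g F by rewrite /= map_mpolyZ mevalZ.
have gX i : g 'X_i = (p 0 i)%:P + (u 0 i)%:P * 'X.
  by rewrite /= map_mpolyX mevalXU /f mul_polyC.
rewrite -[LHS]/(g _) (quartic_rmorph gZ) !gX !quartic_val /l /wval /qval.
move: {gX} (p 0 0) (p 0 1) (p 0 2) (u 0 0) (u 0 1) (u 0 2).
move=> {p u l f g gZ} x y z x' y' z'.
pose T : {poly k} := 'X.
(* Over any ring, [w (p + T u) = W + 2 * A] and [q (p + T u) = Q + 2 * B]. *)
pose A := T * (z * z' + b * y * y' + a * b * x * x')%:P.
pose B := T * (y * y' + a * x * x')%:P.
pose w : {poly k} := (z ^+ 2 + b * y ^+ 2 + a * b * x ^+ 2)%:P.
pose w' : {poly k} := (z' ^+ 2 + b * y' ^+ 2 + a * b * x' ^+ 2)%:P.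
pose q : {poly k} := (y ^+ 2 + x * y + a * x ^+ 2)%:P.
pose q' : {poly k} := (y' ^+ 2 + x' * y' + a * x' ^+ 2)%:P.
pose W := w + T ^+ 2 * w'.
pose Q := q + T * (y * x' + x * y')%:P + T ^+ 2 * q'.
apply: (eq_mod2 (K := c%:P * (2 * x%:P ^+ 3 * T * x'%:P
     + 3 * x%:P ^+ 2 * T ^+ 2 * x'%:P ^+ 2 + 2 * x%:P * T ^+ 3 * x'%:P ^+ 3)
   + W * (e%:P * A + B) + A * (e%:P * W + Q) + 2 * A * (e%:P * A + B)
   + e%:P * T ^+ 2 * w * w') (two0_poly two0)).
by rewrite /W /Q /A /B /w /w' /q /q' /T; ring.
Qed.

Lemma dvdXn_coef (k : fieldType) (p : {poly k}) (n i : nat) :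
  'X^n %| p -> (i < n)%N -> p`_i = 0.
Proof. by move=> /dvdpP[q ->] lt_in; rewrite coefMXn lt_in. Qed.

(** * Singular points and tangents *)

Lemma singularE (k : fieldType) (two0 : 2 = 0 :> k) (a b c e : k)
    (P : curve (quartic a b c e)) :
  singular P = (wval a b (rep P) == 0) || (rep P 0 0 == 0) && (rep P 0 1 == 0).
Proof.
rewrite /singular forall_ord3.
have [-> -> ->] := quartic_partials two0 a b c e (rep P).
rewrite eqxx andbT !mulf_eq0.
by case: (wval _ _ _ == 0); case: (rep P 0 0 == 0); case: (rep P 0 1 == 0).
Qed.

Lemma on_tangentE (k : fieldType) (two0 : 2 = 0 :> k) (a b c e : k)
    (P : curve (quartic a b c e)) (u : 'rV[k]_3) :
  on_tangent P u =
  (wval a b (rep P) * (rep P 0 1 * u 0 0 + rep P 0 0 * u 0 1) == 0).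
Proof.
rewrite /on_tangent sum_ord3.
have [-> -> ->] := quartic_partials two0 a b c e (rep P).
by congr (_ == _); ring.
Qed.

(** At [(0, 0, 1)] the equation of the quartic takes the value [e]. *)
Lemma rep_quartic_xy (k : fieldType) (a b c e : k) (e0 : e != 0)
    (P : curve (quartic a b c e)) :
  ~~ ((rep P 0 0 == 0) && (rep P 0 1 == 0)).
Proof.
apply: contra (rep_neq0 P) => /andP[/eqP x0 /eqP y0].
have := rep_quartic P; rewrite /wval /qval x0 y0 eqxx /= => H.
have /eqP : e * rep P 0 2 ^+ 4 = 0 by rewrite -[RHS]H; ring.
by rewrite mulf_eq0 (negPf e0) expf_eq0.
Qed.

Lemma singular_wval (k : fieldType) (two0 : 2 = 0 :> k) (a b c e : k)
    (e0 : e != 0) (P : curve (quartic a b c e)) :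
  singular P = (wval a b (rep P) == 0).
Proof. by rewrite singularE // (negPf (rep_quartic_xy e0 P)) orbF. Qed.

(** If [w = 0], then the equation forces [x = 0], and [z^2 = b y^2] has a single
    root up to scaling. *)
Lemma wval_eq0 (k : closedFieldType) (char2 : 2%N \in [pchar k])
    (a b c e : k) (c0 : c != 0) (P : curve (quartic a b c e)) :
  (wval a b (rep P) == 0) = (val P == pt 0 1 (sqrt b)).
Proof.
have two0 : 2 = 0 :> k := pcharf0 char2.
apply/eqP/eqP => [w0|/rep_pt[t [_ x0 y0 z0]]]; last first.
  apply: (eq_mod2 (K := t ^+ 2 * b) two0).
  by rewrite /wval x0 y0 z0 exprMn sqrtK; ring.
have := rep_quartic P; rewrite w0 mul0r addr0 => /eqP.
rewrite mulf_eq0 (negPf c0) expf_eq0 /= => /eqP x0.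
have zE : rep P 0 2 = rep P 0 1 * sqrt b.
  apply: (sqr_inj2 char2); rewrite exprMn sqrtK.
  by apply/(eq_addr2 two0); rewrite -[RHS]w0 /wval x0; ring.
have y0 : rep P 0 1 != 0.
  apply: contra (rep_neq0 P) => /eqP y0.
  by rewrite zE y0 mul0r x0 eqxx.
by rewrite curve_pt x0 zE -[RHS](ptZ _ _ _ y0) mulr0 mulr1.
Qed.

(** * Inflection points *)

(** As the strange point lies on all tangents but not on the quartic, it gives a
    tangent direction at every smooth point. *)
Lemma strange_notin (k : fieldType) (a b c e : k) (e0 : e != 0)
    (P : curve (quartic a b c e)) : vec3 0 0 1 \notin val P.
Proof.
apply: contra (rep_quartic_xy e0 P); rewrite curve_pt => /vlineP[t].
rewrite scale_vec3 => H.
have [[tx ty] tz] := vec3E (t * rep P 0 0) (t * rep P 0 1) (t * rep P 0 2).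
rewrite -H in tx ty tz.
have [[nx ny] nz] := vec3E (0 : k) 0 1.
have t0 : t != 0.
  by apply/eqP => t0; move/eqP: tz; rewrite t0 mul0r nz oner_eq0.
have /eqP := esym tx; rewrite nx mulf_eq0 (negPf t0) /= => ->.
by have /eqP := esym ty; rewrite ny mulf_eq0 (negPf t0) /= => ->.
Qed.

(** The linear form [l] that defines the tangent is a factor of the odd terms of
    the expansion. *)
Lemma restrict_tangent (k : fieldType) (two0 : 2 = 0 :> k) (a b c e : k)
    (P : curve (quartic a b c e)) (w0 : wval a b (rep P) != 0)
    (u : 'rV[k]_3) : on_tangent P u ->
  restrict (quartic a b c e) (rep P) u =
    (wval a b u * qval a (rep P) + wval a b (rep P) * qval a u)%:P * 'X^2
    + ((quartic a b c e).@[u 0])%:P * 'X^4.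
Proof.
rewrite on_tangentE // mulf_eq0 (negPf w0) /= => /eqP l0.
rewrite restrict_quartic //= l0 repP !mulr0 !polyC0 !mul0r !add0r.
by rewrite addr0.
Qed.

(** The tangent at a smooth point is spanned by the point and the strange point.
    As [q] does not involve [z], it vanishes on the tangent as soon as it
    vanishes at the point. *)
Lemma qval_tangent (k : fieldType) (two0 : 2 = 0 :> k) (a b c e : k)
    (e0 : e != 0) (P : curve (quartic a b c e)) (w0 : wval a b (rep P) != 0)
    (u : 'rV[k]_3) :
  qval a (rep P) = 0 -> on_tangent P u -> qval a u = 0.
Proof.
move=> q0; rewrite on_tangentE // mulf_eq0 (negPf w0) /= => /eqP.
move/(eq_addr2 two0) => yx.
have x0 : rep P 0 0 != 0.
  apply/eqP => x0; have := rep_quartic_xy e0 P; rewrite x0 eqxx /=.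
  move/eqP: q0; rewrite /qval x0 mul0r expr0n mulr0 !addr0 sqrf_eq0.
  by move=> ->.
apply: (mulfI (expf_neq0 2 x0)); rewrite mulr0.
transitivity ((rep P 0 0 * u 0 1) ^+ 2
  + rep P 0 0 * u 0 0 * (rep P 0 0 * u 0 1)
  + a * (rep P 0 0 * u 0 0) ^+ 2); first by rewrite /qval; ring.
rewrite -yx; transitivity (u 0 0 ^+ 2 * qval a (rep P)).
  by rewrite /qval; ring.
by rewrite q0 mulr0.
Qed.

(** In the direction [(0, 0, 1)] the equation becomes [q(p) T^2 + e T^4]. *)
Lemma tangent_mult_quartic (k : fieldType) (two0 : 2 = 0 :> k) (a b c e : k)
    (e0 : e != 0) (P : curve (quartic a b c e)) (w0 : wval a b (rep P) != 0) :
  [/\ tangent_mult_ge P 3 -> qval a (rep P) = 0,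
      qval a (rep P) = 0 -> tangent_mult_ge P 4
    & ~ tangent_mult_ge P 5].
Proof.
have [[nx ny] nz] := vec3E (0 : k) 0 1.
have tan_n : on_tangent P (vec3 0 0 1).
  by rewrite on_tangentE // nx ny !mulr0 addr0 mulr0.
have rn := restrict_tangent two0 w0 tan_n.
rewrite quartic_val /wval /qval nx ny nz in rn; split.
- move=> /(_ _ (strange_notin e0 P) tan_n) /dvdXn_coef => /(_ 2%N isT).
  rewrite rn coefD !coefCM !coefXn /= => c2.
  by rewrite -[RHS]c2 /qval; ring.
- move=> q0 u _ tu; rewrite restrict_tangent // q0.
  rewrite (qval_tangent two0 e0 w0 q0 tu).
  by rewrite !mulr0 addr0 polyC0 mul0r add0r dvdp_mulIr.
- move=> /(_ _ (strange_notin e0 P) tan_n) /dvdXn_coef => /(_ 4%N isT).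
  rewrite rn coefD !coefCM !coefXn /= => /eqP; apply/negP.
  by rewrite (_ : _ + _ = e) //; ring.
Qed.

Lemma inflectionE (k : fieldType) (two0 : 2 = 0 :> k) (a b c e : k)
    (e0 : e != 0) (P : curve (quartic a b c e)) :
  inflection P <-> wval a b (rep P) != 0 /\ qval a (rep P) = 0.
Proof.
rewrite /inflection singular_wval //.
split=> -[w0 H]; split=> //; have [h3 h4 _] := tangent_mult_quartic two0 e0 w0.
  exact: h3.
move=> u uP tu; apply: dvdp_trans (h4 H u uP tu).
by rewrite dvdp_exp2l.
Qed.

Lemma inflection_non_ordinary (k : fieldType) (two0 : 2 = 0 :> k)
    (a b c e : k) (e0 : e != 0) (P : curve (quartic a b c e)) :
  inflection P -> non_ordinary_inflection P.
Proof.
move=> iP; have [w0 q0] := (inflectionE two0 e0 P).1 iP.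
by have [_ h4 h5] := tangent_mult_quartic two0 e0 w0; split=> //; apply: h4.
Qed.

(** * Orders of elements *)

Lemma has_order_morph (T T' : Type) (zero : T) (add : T -> T -> T)
    (zero' : T') (add' : T' -> T' -> T') (f : T -> T') :
  injective f -> f zero = zero' ->
  (forall x y, f (add x y) = add' (f x) (f y)) ->
  forall x n, has_order zero add x n <-> has_order zero' add' (f x) n.
Proof.
move=> f_inj f0 fD x n.
have fI m : f (iter m (add x) zero) = iter m (add' (f x)) zero'.
  by elim: m => //= m <-; rewrite fD.
split=> -[n0 Hn Hm]; split=> //; first by rewrite -fI Hn.
- by move=> m /Hm ne; rewrite -fI -f0 => /f_inj.
- by apply: f_inj; rewrite fI f0.
- by move=> m /Hm ne /(congr1 f); rewrite fI f0.
Qed.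

Lemma has_order2E (T : Type) (zero : T) (add : T -> T -> T) (x : T) :
  add x zero = x -> has_order zero add x 2 <-> x <> zero /\ add x x = zero.
Proof.
move=> x0; split=> [[_ /= H2 H]|[xn xx]].
  by split; [have := H 1%N isT; rewrite /= x0 | rewrite x0 in H2].
by split=> //= [|[|[|//]] //= _]; rewrite x0.
Qed.

Lemma has_order4E (T : Type) (zero : T) (add : T -> T -> T) (x : T) :
  add x zero = x -> has_order zero add x 4 <->
  [/\ x <> zero, add x x <> zero, add x (add x x) <> zero
    & add x (add x (add x x)) = zero].
Proof.
move=> x0; split=> [[_ /= H4 H]|[x1 x2 x3 x4]].
  split; [have := H 1%N isT | have := H 2%N isT | have := H 3%N isT |];
    by rewrite /= x0 // in H4 *.
by split=> //= [|[|[|[|[|//]]]] //= _]; rewrite x0.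
Qed.

(** * The group law of the cubic in characteristic two *)

Lemma cubic_addT0 (k : fieldType) (a eta x y : k) :
  cubic_add_pt a eta (pt x y 1) (pt 0 1 0) = pt x y 1.
Proof.
have nz : ~~ [&& x == 0, y == 0 & 1 == 0 :> k] by rewrite oner_eq0 !andbF.
have nz' : ~~ [&& 0 == 0 :> k, 1 == 0 :> k & 0 == 0 :> k].
  by rewrite oner_eq0 andbF.
rewrite /cubic_add_pt; have [t t0 ->] := vpick_pt nz.
have [t' _ ->] := vpick_pt nz'.
by rewrite !vec3E mulr1 mulr0 (negPf t0) eqxx.
Qed.

Lemma cubic_add_affine (k : fieldType) (two0 : 2 = 0 :> k)
    (a eta x1 y1 x2 y2 : k) :
  cubic_add_pt a eta (pt x1 y1 1) (pt x2 y2 1) =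
  if (x1 == x2) && (y2 == y1 + x1) then pt 0 1 0 else
  let l := if x1 == x2 then (x1 ^+ 2 + eta + y1) / x1
           else (y2 + y1) / (x2 + x1) in
  let x3 := l ^+ 2 + l + a + x1 + x2 in
  pt x3 (y1 + l * (x3 + x1) + x3) 1.
Proof.
have opp2 (s : k) : - s = s.
  by apply/(eq_addr2 two0); rewrite addNr.
have nz (x y : k) : ~~ [&& x == 0, y == 0 & 1 == 0 :> k].
  by rewrite oner_eq0 !andbF.
rewrite /cubic_add_pt.
have [t t0 ->] := vpick_pt (nz x1 y1); have [t' t'0 ->] := vpick_pt (nz x2 y2).
rewrite !vec3E !mulr1 (negPf t0) (negPf t'0) ![_ * _ / t]mulrAC.
rewrite ![_ * _ / t']mulrAC !divff // !mul1r !opp2.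
have -> : 3 * x1 ^+ 2 + 2 * a * x1 + eta + y1 = x1 ^+ 2 + eta + y1.
  by apply: (eq_mod2 (K := x1 ^+ 2 + a * x1) two0); ring.
by rewrite two0 mul0r add0r.
Qed.

(** The negative of [(x, y)] is [(x, y + x)]. *)
Lemma cubic_add_eq0 (k : fieldType) (two0 : 2 = 0 :> k)
    (a eta x1 y1 x2 y2 : k) :
  cubic_add_pt a eta (pt x1 y1 1) (pt x2 y2 1) = pt 0 1 0 <->
  x1 = x2 /\ y2 = y1 + x1.
Proof.
rewrite cubic_add_affine //; split=> [|[<- ->]]; last by rewrite !eqxx.
by case: ifP => [/andP[/eqP-> /eqP->]|_ /pt_affine_neq].
Qed.

Lemma cubic_double (k : fieldType) (two0 : 2 = 0 :> k) (a eta x y : k)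
    (x0 : x != 0) :
  let l := (x ^+ 2 + eta + y) / x in let x' := l ^+ 2 + l + a in
  cubic_add_pt a eta (pt x y 1) (pt x y 1) =
  pt x' (y + l * (x' + x) + x') 1.
Proof.
move=> l x'; rewrite cubic_add_affine // eqxx /= -/l.
rewrite -[X in X == _]addr0 (inj_eq (addrI y)) eq_sym (negPf x0).
suff -> : l ^+ 2 + l + a + x + x = x' by [].
by apply: (eq_mod2 (K := x) two0); rewrite /x'; ring.
Qed.

Lemma cubic_chord (k : fieldType) (two0 : 2 = 0 :> k) (a eta x1 y1 x2 y2 : k)
    (x12 : x1 != x2) :
  let l := (y2 + y1) / (x2 + x1) in let x3 := l ^+ 2 + l + a + x1 + x2 in
  cubic_add_pt a eta (pt x1 y1 1) (pt x2 y2 1) =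
  pt x3 (y1 + l * (x3 + x1) + x3) 1.
Proof. by move=> l x3; rewrite cubic_add_affine // (negPf x12). Qed.

(** The abscissa of the double of [(x, y)], where [l] is the tangent slope. *)
Lemma cubic_double_x (k : fieldType) (two0 : 2 = 0 :> k) (a eta x y l : k)
    (x0 : x != 0) (Hl : l * x = x ^+ 2 + eta + y) :
  y ^+ 2 + x * y = x ^+ 3 + a * x ^+ 2 + eta * x ->
  (l ^+ 2 + l + a) * x ^+ 2 = (x ^+ 2 + eta) ^+ 2.
Proof.
move=> /(eq_addr2 two0) H.
transitivity ((l * x) ^+ 2 + (l * x) * x + a * x ^+ 2); first by ring.
rewrite Hl; apply: (eq_mod2 (K := y * (x ^+ 2 + eta)) two0).
by rewrite -[RHS]addr0 -H; ring.
Qed.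

Lemma cubic_order2 (k : fieldType) (two0 : 2 = 0 :> k) (a eta x y : k) :
  y ^+ 2 + x * y = x ^+ 3 + a * x ^+ 2 + eta * x ->
  has_order (pt 0 1 0) (cubic_add_pt a eta) (pt x y 1) 2 <-> x = 0.
Proof.
move=> H; rewrite has_order2E ?cubic_addT0 // cubic_add_eq0 //.
split=> [[_ [_ /eqP]]|x0].
  by rewrite -[X in X == _]addr0 (inj_eq (addrI y)) eq_sym => /eqP.
by split; [exact: pt_affine_neq | rewrite x0 addr0].
Qed.

(** Let [(x', y')] be the double of [(x, y)] and [l] the slope of the tangent.
    If [x' = 0], then the double is the element [(0, 0)] of order two.
    Conversely, if the order is four, then the chord from [(x, y)] to [(x', y')]
    meets the cubic again on the vertical through [(x, y)]; this says that its
    slope [m] satisfies [m ^+ 2 + m + a = x' = l ^+ 2 + l + a], hence [m = l] or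
    [m = l + 1], and only the former is possible, with [x' = 0]. As
    [x' * x ^+ 2 = (x ^+ 2 + eta) ^+ 2], the condition is [x ^+ 2 = eta]. *)
Lemma cubic_order4 (k : fieldType) (two0 : 2 = 0 :> k) (a eta x y : k)
    (eta0 : eta != 0) :
  y ^+ 2 + x * y = x ^+ 3 + a * x ^+ 2 + eta * x ->
  has_order (pt 0 1 0) (cubic_add_pt a eta) (pt x y 1) 4 <-> x ^+ 2 = eta.
Proof.
move=> H; rewrite has_order4E ?cubic_addT0 //.
have [x0|x0] := eqVneq x 0.
  split=> [[_ D0]|x2]; first by case: D0; rewrite cubic_add_eq0 // x0 addr0.
  by case/eqP: eta0; rewrite -x2 x0 expr0n.
have := cubic_double two0 a eta y x0; cbv zeta.
have := divfK x0 (x ^+ 2 + eta + y); move: (_ / x) => l Hl.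
have := cubic_double_x two0 x0 Hl H.
set x' := _ + a => Hx' ->; set y' := y + _ + _.
split=> [[_ _ D3 D4]|x2].
  have x'x : x != x'.
    apply/eqP=> E; apply: D3; apply/cubic_add_eq0 => //; split=> //.
    rewrite /y' -E; apply: (eq_mod2 (K := l * x) two0); ring.
  move: D4; rewrite cubic_chord // cubic_add_eq0 //.
  have d0 : x' + x != 0.
    by apply: contra x'x => /eqP /(eq_addr2 two0) ->.
  have := divfK d0 (y' + y); move: (_ / _) => m Hm [] Ex _.
  have El : m ^+ 2 + m = l ^+ 2 + l.
    apply/(eq_addr2 two0); apply: (eq_mod2 (K := - a) two0).
    transitivity (m ^+ 2 + m + a + x + x' - x - 2 * a).
      by rewrite /x'; ring.
    by rewrite -Ex; ring.
  have {}Hm : m * (x' + x) = l * (x' + x) + x'.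
    by rewrite Hm /y'; apply: (eq_mod2 (K := y) two0); ring.
  have x'0 : x' = 0.
    case: (artin_schreier_eq two0 El) => E; move: Hm; rewrite E.
      by rewrite -[LHS]addr0 => /addrI.
    rewrite mulrDl mul1r => /addrI.
    by rewrite -[RHS]addr0 => /addrI /eqP; rewrite (negPf x0).
  move/eqP: Hx'; rewrite x'0 mul0r eq_sym sqrf_eq0.
  by move=> /eqP /(eq_addr2 two0).
have x'0 : x' = 0.
  apply: (mulIf (expf_neq0 2 x0)); rewrite Hx' x2 mul0r.
  by apply: (eq_mod2 (K := 2 * eta ^+ 2) two0); ring.
(* The double is the element [(0, 0)], and adding it to [(x, y)] gives the
   negative of [(x, y)]. *)
have y'0 : y' = 0.
  rewrite /y' x'0 add0r Hl x2.
  by apply: (eq_mod2 (K := y + eta) two0); ring.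
rewrite x'0 y'0.
have C : cubic_add_pt a eta (pt x y 1) (pt 0 0 1) = pt x (y + x) 1.
  rewrite cubic_chord // !add0r addr0.
  have := divfK x0 y; move: (y / x) => m Hm.
  have -> : m ^+ 2 + m + a + x = x.
    apply: (mulIf (expf_neq0 2 x0)).
    apply: (eq_mod2 (K := a * x ^+ 2 + x ^+ 3) two0).
    transitivity ((m * x) ^+ 2 + x * (m * x) + a * x ^+ 2 + x ^+ 3).
      by ring.
    by rewrite Hm H -x2; ring.
  by congr pt; apply: (eq_mod2 (K := m * x) two0); ring.
rewrite C; split; try exact: pt_affine_neq.
by apply/cubic_add_eq0.
Qed.

(** * Orders on the quartic *)

Lemma quartic_order_cubic (k : closedFieldType) (char2 : 2%N \in [pchar k])
    (a b c e : k) (ce0 : c * e != 0) (P : curve (quartic a b c e)) (n : nat) :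
  quartic_order char2 ce0 P n <->
  has_order (pt 0 1 0) (cubic_add_pt a (c * e)) (val (to_cubic P)) n.
Proof.
apply: (has_order_morph (f := fun R => val (to_cubic R))) => [||x y].
- exact: inj_comp val_inj (to_cubic_inj char2 ce0).
- exact: (congr1 val (of_cubicK b char2 ce0 (cubic_zero a (c * e)))).
- exact: (congr1 val (of_cubicK b char2 ce0 (cubic_add _ _))).
Qed.

Lemma val_quartic_zero (k : closedFieldType) (char2 : 2%N \in [pchar k])
    (a b c e : k) (ce0 : c * e != 0) :
  val (quartic_zero a b char2 ce0) = pt 0 1 (sqrt b).
Proof.
have two0 : 2 = 0 :> k := pcharf0 char2.
have on : on_curve (quartic a b c e) (pt 0 1 (sqrt b)).
  apply: on_quartic_pt; first by rewrite oner_eq0 andbF.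
  rewrite quarticE !vec3E /= sqrtK.
  by apply: (eq_mod2 (K := b * (2 * e * b + 1)) two0); ring.
rewrite -[RHS]/(val (Sub (pt 0 1 (sqrt b)) on : curve (quartic a b c e))).
apply: (congr1 val); apply: (to_cubic_inj char2 ce0).
apply: etrans (of_cubicK b char2 ce0 (cubic_zero a (c * e))) _.
by rewrite to_cubic_zero.
Qed.

Lemma val_to_cubic (k : closedFieldType) (char2 : 2%N \in [pchar k])
    (a b c e : k) (ce0 : c * e != 0) (P : curve (quartic a b c e))
    (w0 : wval a b (rep P) != 0) :
  let X := c * rep P 0 0 ^+ 2 / wval a b (rep P) in
  let Y := c * rep P 0 0 * rep P 0 1 / wval a b (rep P) in
  val (to_cubic P) = pt X Y 1 /\
  Y ^+ 2 + X * Y = X ^+ 3 + a * X ^+ 2 + c * e * X.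
Proof.
have two0 : 2 = 0 :> k := pcharf0 char2.
have c0 : c != 0 by move: ce0; rewrite mulf_eq0 => /norP[].
move=> X Y; split.
  rewrite to_cubicE //; last by rewrite -(wval_eq0 char2).
  rewrite -[RHS](@ptZ _ (wval a b (rep P))) // mulr1 /X /Y.
  by rewrite ![_ * (_ / _)]mulrC !divfK.
have := rep_quartic P; rewrite /X /Y {X Y}; move: (wval _ _ _) w0 => w w0.
rewrite /qval; move: (rep P 0 0) (rep P 0 1) => x y HP.
apply/(eq_addr2 two0).
transitivity (c ^+ 2 * x ^+ 2 / w ^+ 3
  * (c * x ^+ 4 + w * (e * w + (y ^+ 2 + x * y + a * x ^+ 2)))).
  by field.
by rewrite HP mulr0.
Qed.

Lemma quartic_order_singular (k : closedFieldType) (char2 : 2%N \in [pchar k])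
    (a b c e : k) (ce0 : c * e != 0) (P : curve (quartic a b c e)) (n : nat) :
  (1 < n)%N -> quartic_order char2 ce0 P n -> wval a b (rep P) != 0.
Proof.
have c0 : c != 0 by move: ce0; rewrite mulf_eq0 => /norP[].
move=> n1 /quartic_order_cubic[_ _ /(_ 1%N n1) /= H].
apply/negP; rewrite (wval_eq0 char2) // => /eqP Ps; apply: H.
rewrite to_cubic_zero //= /cubic_add_pt.
have [|t _ ->] := @vpick_pt k 0 1 0; first by rewrite oner_eq0 andbF.
by rewrite !vec3E mulr0 ifT.
Qed.

(** The abscissa of the image is [c x^2 / w]. *)
Lemma quartic_order2 (k : closedFieldType) (char2 : 2%N \in [pchar k])
    (a b c e : k) (ce0 : c * e != 0) (P : curve (quartic a b c e)) :
  quartic_order char2 ce0 P 2 <->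
  wval a b (rep P) != 0 /\ rep P 0 0 = 0.
Proof.
have two0 : 2 = 0 :> k := pcharf0 char2.
have c0 : c != 0 by move: ce0; rewrite mulf_eq0 => /norP[].
have main : wval a b (rep P) != 0 ->
    quartic_order char2 ce0 P 2 <-> rep P 0 0 = 0.
  move=> w0; have [PE HE] := val_to_cubic char2 ce0 w0.
  apply: iff_trans (quartic_order_cubic _ _ _ _) _.
  rewrite PE; apply: iff_trans (cubic_order2 two0 HE) _.
  split=> [/eqP|->]; last by rewrite expr0n mulr0 mul0r.
  by rewrite !mulf_eq0 invr_eq0 (negPf w0) (negPf c0) orbF orbb => /eqP.
split=> [H|[w0 /(main w0)//]].
have w0 := quartic_order_singular (n := 2) isT H.
by split=> //; apply: (main w0).1.
Qed.

(** The abscissa [X = c x^2 / w] of the image satisfies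
    [X^2 + c e = - q c / w], because of the equation of the quartic. *)
Lemma quartic_order4 (k : closedFieldType) (char2 : 2%N \in [pchar k])
    (a b c e : k) (ce0 : c * e != 0) (P : curve (quartic a b c e)) :
  quartic_order char2 ce0 P 4 <->
  wval a b (rep P) != 0 /\ qval a (rep P) = 0.
Proof.
have two0 : 2 = 0 :> k := pcharf0 char2.
have c0 : c != 0 by move: ce0; rewrite mulf_eq0 => /norP[].
have main : wval a b (rep P) != 0 ->
    quartic_order char2 ce0 P 4 <-> qval a (rep P) = 0.
  move=> w0; have [PE HE] := val_to_cubic char2 ce0 w0.
  apply: iff_trans (quartic_order_cubic _ _ _ _) _.
  rewrite PE; apply: iff_trans (cubic_order4 two0 ce0 HE) _.
  have := rep_quartic P; move: (wval _ _ _) (qval _ _) w0 => w q w0.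
  move: (rep P 0 0) => x HP.
  have dE : (c * x ^+ 2 / w) ^+ 2 + c * e = q * (- c / w).
    transitivity (c / w ^+ 2 * (c * x ^+ 4 + w * (e * w + q)) + q * (- c / w)).
      by field.
    by rewrite HP mulr0 add0r.
  split=> [/(eq_addr2 two0) /eqP|q0]; last first.
    by apply/(eq_addr2 two0); rewrite dE q0 mul0r.
  rewrite dE !mulf_eq0 invr_eq0 oppr_eq0 (negPf w0) (negPf c0) !orbF.
  by move/eqP.
split=> [H|[w0 /(main w0)//]].
have w0 := quartic_order_singular (n := 4) isT H.
by split=> //; apply: (main w0).1.
Qed.

(** * The inflection points *)

(** The point with [x = 1] on the line [y = r x] where [e w^2 = c x^4]; the last
    coordinate is obtained by solving [w = sqrt (c / e)] for [z]. *)
Definition flex (k : closedFieldType) (a b c e r : k) : {vspace 'rV[k]_3} :=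
  pt 1 r (sqrt (sqrt (c / e) + b * r ^+ 2 + a * b)).

Lemma flex_on (k : closedFieldType) (two0 : 2 = 0 :> k) (a b c e r : k)
    (e0 : e != 0) (Hr : r ^+ 2 + r = a) :
  on_curve (quartic a b c e) (flex a b c e r).
Proof.
apply: on_quartic_pt; first by rewrite oner_eq0.
rewrite quarticE !vec3E /= sqrtK -{}Hr.
have := sqrtK (c / e); set s := sqrt _ => Hs.
have -> : c = s ^+ 2 * e by rewrite Hs divfK.
set B := b * r ^+ 2 + (r ^+ 2 + r) * b.
apply: (eq_mod2 (K := e * (s ^+ 2 + 2 * s * B + 2 * B ^+ 2)
  + (s + 2 * B) * (r ^+ 2 + r)) two0).
by rewrite /B; ring.
Qed.

Lemma flexP (k : closedFieldType) (char2 : 2%N \in [pchar k]) (a b c e r : k)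
    (c0 : c != 0) (e0 : e != 0) (Hr : r ^+ 2 + r = a)
    (P : curve (quartic a b c e)) :
  val P = flex a b c e r <->
  [/\ wval a b (rep P) != 0, qval a (rep P) = 0
    & rep P 0 1 = r * rep P 0 0].
Proof.
have two0 : 2 = 0 :> k := pcharf0 char2.
have s0 : sqrt (c / e) != 0.
  by rewrite -sqrf_eq0 sqrtK mulf_neq0 ?invr_eq0.
split=> [/rep_pt[t [t0 x0 y0 z0]]|[w0 q0 y0]].
  rewrite /wval /qval x0 y0 z0 exprMn sqrtK; split.
  - rewrite (_ : _ + _ = t ^+ 2 * sqrt (c / e)).
      by rewrite mulf_neq0 // expf_eq0.
    by apply: (eq_mod2 (K := t ^+ 2 * (b * r ^+ 2 + a * b)) two0); ring.
  - apply: (eq_mod2 (K := t ^+ 2 * a) two0).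
    by rewrite -Hr; ring.
  - by rewrite mulr1 mulrC.
have x0 : rep P 0 0 != 0.
  by apply: contra (rep_quartic_xy e0 P) => /eqP x0; rewrite y0 x0 mulr0 eqxx.
have wE : wval a b (rep P) = sqrt (c / e) * rep P 0 0 ^+ 2.
  apply: (sqr_inj2 char2); rewrite exprMn sqrtK.
  apply: (mulfI e0).
  transitivity (c * rep P 0 0 ^+ 4); last by field.
  apply/(eq_addr2 two0).
  by rewrite -[RHS](rep_quartic P) q0; ring.
rewrite curve_pt /flex -[RHS](ptZ _ _ _ x0); congr pt.
- by rewrite mulr1.
- by rewrite y0 mulrC.
- apply: (sqr_inj2 char2); rewrite exprMn sqrtK !mulrDr.
  rewrite [_ * sqrt _]mulrC -wE /wval y0.
  apply: (eq_mod2 (K := - (b * r ^+ 2 + a * b) * rep P 0 0 ^+ 2) two0).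
  by ring.
Qed.

(** On [q = 0] the quotient [y / x] is a root of [T^2 + T + a]. *)
Lemma flex_cases (k : closedFieldType) (char2 : 2%N \in [pchar k])
    (a b c e r : k) (c0 : c != 0) (e0 : e != 0) (Hr : r ^+ 2 + r = a)
    (P : curve (quartic a b c e)) :
  wval a b (rep P) != 0 /\ qval a (rep P) = 0 <->
  val P = flex a b c e r \/ val P = flex a b c e (r + 1).
Proof.
have two0 : 2 = 0 :> k := pcharf0 char2.
have Hr1 : (r + 1) ^+ 2 + (r + 1) = a.
  by apply: (eq_mod2 (K := r + 1) two0); rewrite -Hr; ring.
split=> [[w0 q0]|]; last first.
  by case=> [/(flexP char2 c0 e0 Hr)|/(flexP char2 c0 e0 Hr1)] [].
have x0 : rep P 0 0 != 0.
  apply: contra (rep_quartic_xy e0 P) => /eqP x0; rewrite x0 eqxx /=.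
  by move/eqP: q0; rewrite /qval x0 mul0r expr0n mulr0 !addr0 sqrf_eq0.
have /(artin_schreier_eq two0) :
    (rep P 0 1 / rep P 0 0) ^+ 2 + rep P 0 1 / rep P 0 0 = r ^+ 2 + r.
  rewrite Hr; apply/(eq_addr2 two0).
  transitivity (qval a (rep P) / rep P 0 0 ^+ 2); last by rewrite q0 mul0r.
  by rewrite /qval; field.
case=> E; [left; apply/(flexP char2 c0 e0 Hr) | right;
  apply/(flexP char2 c0 e0 Hr1)]; by rewrite -E divfK.
Qed.

(** * The degenerations *)

Lemma order_two_ptE (k : closedFieldType) (b e : k) : e != 0 ->
  order_two_pt b e = pt 0 1 (sqrt b + (sqrt e)^-1).
Proof.
move=> e0; have s0 : sqrt e != 0 by rewrite -sqrf_eq0 sqrtK.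
rewrite /order_two_pt -[RHS](ptZ _ _ _ s0) mulr0 mulr1 mulrDr divff //.
by rewrite addrC mulrC.
Qed.

Lemma order_two_pt0 (k : closedFieldType) (b : k) :
  order_two_pt b 0 = pt 0 0 1.
Proof. by rewrite /order_two_pt sqrt0 mulr0 addr0. Qed.

(** On the line [x = 0] the conic is [e * z ^+ 2 = (1 + b * e) * y ^+ 2]. *)
Lemma order_two_ptP (k : closedFieldType) (char2 : 2%N \in [pchar k])
    (b e : k) (e0 : e != 0) (y z : k) :
  ~~ ((y == 0) && (z == 0)) ->
  e * (z ^+ 2 + b * y ^+ 2) + y ^+ 2 = 0 <-> pt 0 y z = order_two_pt b e.
Proof.
move=> yz; have two0 : 2 = 0 :> k := pcharf0 char2.
have: sqrt e != 0 by rewrite -sqrf_eq0 sqrtK.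
rewrite /order_two_pt; move: (sqrtK e) (sqrtK b).
move: {e0} (sqrt e) (sqrt b) => s r <- <- s0.
split=> [H|/pt_inj[t [_ -> ->]]]; last first.
  by apply: (eq_mod2 (K := t ^+ 2 * s ^+ 2 * (1 + r * s + r ^+ 2 * s ^+ 2))
                two0); ring.
have zE : s * z = y * (1 + r * s).
  apply: (sqr_inj2 char2).
  apply: (eq_mod2 (K := - y ^+ 2 * (1 + r * s + r ^+ 2 * s ^+ 2)) two0).
  transitivity (s ^+ 2 * (z ^+ 2 + r ^+ 2 * y ^+ 2) + y ^+ 2
                - y ^+ 2 * (1 + r ^+ 2 * s ^+ 2)); first by ring.
  by rewrite H; ring.
have y0 : y != 0.
  apply: contra yz => /eqP y0; move/eqP: zE.
  by rewrite y0 mul0r mulf_eq0 (negPf s0) eqxx.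
by rewrite -[LHS](ptZ _ _ _ s0) zE -[RHS](ptZ _ _ _ y0) !mulr0 [s * y]mulrC.
Qed.

(** The leading form of the quartic at [(0, 0, t)] is [t^2 q], and [q] splits
    into [y + r x] and [y + (r + 1) x]. *)
Lemma node_strange (k : closedFieldType) (two0 : 2 = 0 :> k) (a b c r : k)
    (Hr : r ^+ 2 + r = a) (P : curve (quartic a b c 0)) :
  val P = pt 0 0 1 -> node P.
Proof.
case/rep_pt=> t [t0 x0 y0 z0]; rewrite !mulr0 mulr1 in x0 y0 z0.
pose L : 'M[k]_(3, 2) := \matrix_(i, j) [:: t * (r + j%:R); t; 0]`_i.
have LE (u : 'rV[k]_3) (j : 'I_2) :
    (u *m L) 0 j = u 0 0 * (t * (r + j%:R)) + u 0 1 * t.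
  by rewrite mxE sum_ord3 !mxE /= mulr0 addr0.
have LE0 (u : 'rV[k]_3) : (u *m L) 0 0 = u 0 0 * (t * r) + u 0 1 * t.
  by rewrite LE addr0.
have LE1 (u : 'rV[k]_3) : (u *m L) 0 1 = u 0 0 * (t * (r + 1)) + u 0 1 * t.
  by rewrite LE.
exists L; split.
- apply/eqP; rewrite eqn_leq rank_leq_col /=.
  (* [M] is a left inverse of [L]. *)
  pose M : 'M[k]_(2, 3) :=
    \matrix_(i, j) [:: t^-1; (r + 1 + i%:R) / t; 0]`_j.
  apply: (@mulmx1_min_rank _ 2 _ _ _ M 1%:M); rewrite mulmx1.
  apply/matrixP => i j; rewrite !mxE sum_ord3 !mxE /= mulr0 addr0.
  have -> : t^-1 * (t * (r + j%:R)) + (r + 1 + i%:R) / t * t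
      = 1 + (i%:R + j%:R) + 2 * r :> k by field.
  rewrite two0 mul0r addr0.
  case: i j => [[|[|//]] ?] [[|[|//]] ?] /=.
  + by rewrite !addr0.
  + by rewrite add0r; exact: two0.
  + by rewrite addr0; exact: two0.
  + by rewrite (two0 : 1 + 1 = 0 :> k) addr0.
- by apply/rowP => j; rewrite LE x0 y0 !mul0r addr0 mxE.
- move=> u; rewrite restrict_quartic // repP LE0 LE1 /wval /qval x0 y0 z0.
  move: (quartic _ _ _ _).@[_] => G.
  rewrite -mul_polyC -Hr (_ : _ - _ = G%:P * 'X * 'X^3) ?dvdp_mulIr //.
  apply: (eq_mod2 (K := - (r * t ^+ 2 * u 0 0 * u 0 1)%:P * 'X^2)
            (two0_poly two0)).
  by ring.
Qed.

(** The leading form at [(0, t, t sqrt b)], the other singular point, is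
    [t^2 w]. If it is the product of two linear forms, then these are
    proportional: as [w] is additive, comparing its values at a unit vector, at
    [(0, 0, 1)] and at their sum shows that the minors of [L] that involve the
    last row vanish ([cross] below), whereas the entries of this row do not. *)
Lemma node_quartic_e0 (k : closedFieldType) (char2 : 2%N \in [pchar k])
    (a b c : k) (c0 : c != 0) (P : curve (quartic a b c 0)) :
  node P -> val P = pt 0 0 1.
Proof.
have two0 : 2 = 0 :> k := pcharf0 char2.
case=> L [rL _ HL].
(* The coefficients of [T] and of [T^2] in the expansion at [P]. *)
have coefs (u : 'rV[k]_3) :
    wval a b (rep P) * (rep P 0 1 * u 0 0 + rep P 0 0 * u 0 1) = 0
    /\ wval a b u * qval a (rep P) + wval a b (rep P) * qval a u
       = (u *m L) 0 0 * (u *m L) 0 1.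
  have := HL u; rewrite restrict_quartic // -mul_polyC => H.
  have H1 := dvdXn_coef H (isT : (1 < 3)%N).
  have H2 := dvdXn_coef H (isT : (2 < 3)%N).
  rewrite !(coefN, coefD, coefCM, coefXn, coefX, coefC) /= in H1 H2.
  split; first by rewrite -[RHS]H1; ring.
  by apply/eqP; rewrite -subr_eq0 -[X in _ == X]H2; apply/eqP; ring.
have [w0|w0] := eqVneq (wval a b (rep P)) 0; last first.
  have [] := coefs (vec3 1 0 0); have [] := coefs (vec3 0 1 0).
  rewrite !vec3E !mulr1 !mulr0 add0r addr0 => /eqP.
  rewrite mulf_eq0 (negPf w0) /= => /eqP x0 _ /eqP.
  rewrite mulf_eq0 (negPf w0) /= => /eqP y0 _.
  have z0 : rep P 0 2 != 0 by have := rep_neq0 P; rewrite x0 y0 eqxx.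
  by rewrite curve_pt x0 y0 -[RHS](ptZ _ _ _ z0) mulr0 mulr1.
have := w0 => /eqP; rewrite (wval_eq0 char2) // => /eqP /rep_pt[t [t0 x0 y0 _]].
rewrite mulr0 in x0; rewrite mulr1 in y0.
have LE (u : 'rV[k]_3) : (u *m L) 0 0 * (u *m L) 0 1 = t ^+ 2 * wval a b u.
  have [_ <-] := coefs u.
  by rewrite w0 mul0r addr0 /qval x0 y0; ring.
have lin (i : 'I_3) (s : k) :
    (L i 0 + s * L 2 0) * (L i 1 + s * L 2 1)
    = t ^+ 2 * wval a b (delta_mx 0 i + s *: delta_mx 0 2).
  by rewrite -LE mulmxDl -scalemxAl -!rowE !mxE.
have L2 : L 2 0 * L 2 1 = t ^+ 2.
  have := lin 2 0; rewrite /wval !mxE /= !mul0r !addr0 => ->.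
  by rewrite expr1n expr0n !mulr0 !addr0 mulr1.
have cross (i : 'I_3) : L i 0 * L 2 1 + L i 1 * L 2 0 = 0.
  have := lin i 1; have := lin i 0; rewrite /wval !mxE !eqxx /=.
  rewrite !mulr0 !mul0r !mul1r !addr0.
  move: (2 == i)%:R (1 == i)%:R (0 == i)%:R => d2 d1 d0 h0 h1.
  apply: (eq_mod2 (K := t ^+ 2 * d2) two0).
  transitivity ((L i 0 + L 2 0) * (L i 1 + L 2 1) - L i 0 * L i 1
                - L 2 0 * L 2 1); first by ring.
  by rewrite h1 h0 L2; ring.
pose v : 'rV[k]_2 := \row_j [:: L 2 1; L 2 0]`_j.
have vL : v *m L^T = 0.
  apply/rowP => i; rewrite !mxE !big_ord_recl big_ord0 !mxE /= addr0.
  by rewrite -[RHS](cross i) mulrC [X in _ + X]mulrC; congr (_ * _ + _ * _);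
    congr (L _ _); apply: val_inj.
have free_L : row_free L^T by rewrite /row_free mxrank_tr rL.
have : v == 0 by rewrite -(mulmx_free_eq0 v free_L) vL.
move/eqP/rowP/(_ 0); rewrite !mxE /= => l0.
by move/eqP: L2; rewrite l0 mulr0 eq_sym expf_eq0 (negPf t0).
Qed.

(** Where [x = 0] and [w != 0], the quartic reduces to the conic [e w + y^2]. *)
Lemma order_two_quartic (k : closedFieldType) (char2 : 2%N \in [pchar k])
    (a b c e : k) (e0 : e != 0) (P : curve (quartic a b c e)) :
  wval a b (rep P) != 0 /\ rep P 0 0 = 0 <-> val P = order_two_pt b e.
Proof.
have HF := rep_quartic P; split=> [[w0 x0]|PE].
  have yz : ~~ ((rep P 0 1 == 0) && (rep P 0 2 == 0)).
    by have := rep_neq0 P; rewrite x0 eqxx.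
  rewrite x0 in HF; rewrite curve_pt x0.
  apply/(order_two_ptP char2 b e0 yz).
  apply: (mulfI w0); rewrite mulr0 -[RHS]HF /qval /wval x0; ring.
have [t [_ x0 _ _]] := rep_pt PE; rewrite mulr0 in x0; split=> //.
have yz : ~~ ((rep P 0 1 == 0) && (rep P 0 2 == 0)).
  by have := rep_neq0 P; rewrite x0 eqxx.
rewrite curve_pt x0 in PE.
apply/eqP => w0; move/negP: (yz); apply.
have /eqP : rep P 0 1 ^+ 2 = 0.
  rewrite -[RHS]((order_two_ptP char2 b e0 yz).2 PE) -[LHS]add0r.
  by congr (_ + _); rewrite -[LHS](mulr0 e) -w0 /wval x0; ring.
rewrite sqrf_eq0 => y0; rewrite y0 /=.
by rewrite -sqrf_eq0 -w0 /wval x0 (eqP y0); apply/eqP; ring.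
Qed.

Lemma order_two_on_quartic (k : closedFieldType) (two0 : 2 = 0 :> k)
    (a b c e : k) : on_curve (quartic a b c e) (order_two_pt b e).
Proof.
have nz : ~~ [&& 0 == 0 :> k, sqrt e == 0 & 1 + sqrt b * sqrt e == 0].
  apply/negP => /and3P[_ /eqP-> ].
  by rewrite mulr0 addr0 oner_eq0.
apply: on_quartic_pt nz _; rewrite quarticE !vec3E /=.
move: (sqrtK e) (sqrtK b); move: (sqrt e) (sqrt b) => s r <- <-.
pose A := r * s + r ^+ 2 * s ^+ 2.
apply: (eq_mod2 (K := (1 + 2 * A) * s ^+ 2 * (1 + A)) two0).
by rewrite /A; ring.
Qed.

Lemma conicE (k : fieldType) (a b e : k) (v : 'rV[k]_3) :
  (conic a b e).@[v 0] = e * wval a b v + qval a v.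
Proof.
rewrite /conic !(mevalD, mevalM, mevalZ, wformE, rmorphXn) /=.
by rewrite !mevalXU.
Qed.

Lemma order_two_on_conic (k : closedFieldType) (char2 : 2%N \in [pchar k])
    (a b e : k) (e0 : e != 0) : on_curve (conic a b e) (order_two_pt b e).
Proof.
have s0 : sqrt e != 0 by rewrite -sqrf_eq0 sqrtK.
have nz : ~~ [&& 0 == 0 :> k, sqrt e == 0 & 1 + sqrt b * sqrt e == 0].
  by rewrite (negPf s0) andbF.
rewrite /on_curve {1}/order_two_pt dim_vline vec3_eq0 nz /=.
have [t t0 E] := vpick_pt nz; rewrite conicE E /wval /qval !vec3E.
apply/eqP; set y := t * sqrt e; set z := t * (_ + _).
rewrite -[RHS]((order_two_ptP char2 b e0 (y := y) (z := z) _).2 _).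
- by ring.
- by rewrite mulf_eq0 (negPf t0) (negPf s0).
- by rewrite /order_two_pt -[RHS](ptZ _ _ _ t0) mulr0.
Qed.

Lemma order_two_conic (k : closedFieldType) (char2 : 2%N \in [pchar k])
    (a b e : k) (e0 : e != 0) (P : curve (conic a b e)) :
  rep P 0 0 = 0 <-> val P = order_two_pt b e.
Proof.
split=> [x0|/rep_pt[t [_ -> _ _]]]; last by rewrite mulr0.
have yz : ~~ ((rep P 0 1 == 0) && (rep P 0 2 == 0)).
  by have := rep_neq0 P; rewrite x0 eqxx.
rewrite curve_pt x0; apply/(order_two_ptP char2 b e0 yz).
by rewrite -[RHS](repP P) conicE /wval /qval x0; ring.
Qed.

Lemma mem_line_x0 (k : fieldType) (s : k) (v : 'rV[k]_3) :
  v \in (pt 0 1 s + pt 0 0 1)%VS <-> v 0 0 = 0.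
Proof.
split=> [/memv_addP[_ /vlineP[t ->] [_ /vlineP[t' ->] ->]]|v0].
  by rewrite !scale_vec3 !mxE /= !mulr0 addr0.
rewrite (_ : v = v 0 1 *: vec3 0 1 s + (v 0 2 - v 0 1 * s) *: vec3 0 0 1).
  by apply: memv_add; apply: memvZ; apply: memv_line.
rewrite !scale_vec3 -[LHS]vec3K v0; apply/rowP => i; rewrite !mxE.
by case: i => [[|[|[|//]]] Hi] /=; ring.
Qed.

Theorem proposition3p4 (k : closedFieldType) (char2 : 2%N \in [pchar k])
    (a b c e : k) (ce_neq0 : c * e != 0) :
  (* the neutral element is the unique singular point *)
  (val (quartic_zero a b char2 ce_neq0) = pt 0 1 (sqrt b) /\
   forall P : curve (quartic a b c e),
     singular P <-> P = quartic_zero a b char2 ce_neq0) /\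
  (* (0 : 1 : b^{1/2}) and the strange point (0 : 0 : 1) span {x = 0} *)
  ((forall P : curve (quartic a b c e),
      ~~ singular P -> on_tangent P (vec3 0 0 1)) /\
   forall v : 'rV[k]_3,
     v \in (pt 0 1 (sqrt b) + pt 0 0 1)%VS <-> v 0 0 = 0) /\
  (* (i) *)
  (exists T : curve (quartic a b c e),
     [/\ val T = pt 0 1 (sqrt b + (sqrt e)^-1),
         val T = order_two_pt b e,
         forall P : curve (quartic a b c e),
           quartic_order char2 ce_neq0 P 2 <-> P = T &
         forall P : curve (quartic a b c e),
           (~~ singular P /\ rep P 0 0 = 0) <-> P = T]) /\
  (* the specialization at e = 0 *)
  (exists N : curve (quartic a b c 0),
     val N = order_two_pt b 0 /\
     forall P : curve (quartic a b c 0), node P <-> P = N) /\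
  (* the specialization at c = 0 *)
  (exists N : curve (conic a b e),
     val N = order_two_pt b e /\
     forall P : curve (conic a b e), rep P 0 0 = 0 <-> P = N) /\
  (* (ii) *)
  (exists P1 P2 : curve (quartic a b c e),
     [/\ P1 <> P2,
         forall P : curve (quartic a b c e),
           quartic_order char2 ce_neq0 P 4 <-> (P = P1 \/ P = P2),
         forall P : curve (quartic a b c e),
           inflection P <-> (P = P1 \/ P = P2),
         non_ordinary_inflection P1 & non_ordinary_inflection P2]).
Proof.
have two0 : 2 = 0 :> k := pcharf0 char2.
have [c0 e0] : c != 0 /\ e != 0.
  by move: ce_neq0; rewrite mulf_eq0 => /norP[].
have val_iff F (P R : curve F) : val P = val R <-> P = R.
  by split=> [/val_inj|->].
have [r Hr] : exists r : k, r ^+ 2 + r = a.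
  have [r] := @solve_monicpoly k 2 (nth 0 [:: a; - 1]) isT.
  rewrite !big_ord_recl big_ord0 /= => Er; exists r.
  by rewrite Er; ring.
have Hr1 : (r + 1) ^+ 2 + (r + 1) = a.
  by apply: (eq_mod2 (K := r + 1) two0); rewrite -Hr; ring.
split.
  split=> [|P]; first exact: val_quartic_zero.
  rewrite -val_iff val_quartic_zero singular_wval //.
  by rewrite (wval_eq0 char2) //; split=> /eqP.
split.
  split=> [P _|v]; last exact: mem_line_x0.
  by rewrite on_tangentE // !vec3E !mulr0 addr0 mulr0.
split; last split; last split.
- exists (Sub (order_two_pt b e) (order_two_on_quartic two0 a b c e)).
  have T2 (P : curve (quartic a b c e)) := order_two_quartic char2 e0 P.
  split=> [||P|P] /=; first exact: order_two_ptE; first by [].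
    by rewrite -val_iff /= -T2; apply: quartic_order2.
  by rewrite -val_iff /= -T2 singular_wval.
- exists (Sub (order_two_pt b 0) (order_two_on_quartic two0 a b c 0)).
  split=> // P; rewrite -val_iff /= order_two_pt0; split.
    exact: node_quartic_e0.
  exact: node_strange Hr _.
- exists (Sub (order_two_pt b e) (order_two_on_conic char2 a b e0)).
  by split=> // P; rewrite -val_iff /=; apply: order_two_conic.
pose P1 : curve (quartic a b c e) :=
  Sub (flex a b c e r) (flex_on two0 b c e0 Hr).
pose P2 : curve (quartic a b c e) :=
  Sub (flex a b c e (r + 1)) (flex_on two0 b c e0 Hr1).
have cases P := flex_cases char2 c0 e0 Hr P.
have infl P : inflection P <-> P = P1 \/ P = P2.
  by rewrite -!val_iff -cases; apply: inflectionE.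
exists P1, P2; split.
- move=> /(congr1 val) /pt_inj[t []].
  rewrite mulr1 => <-; rewrite mul1r -[X in X = _]addr0 => /addrI /esym /eqP.
  by rewrite oner_eq0.
- by move=> P; rewrite -!val_iff -cases; apply: quartic_order4.
- exact: infl.
- by apply: inflection_non_ordinary => //; apply/infl; left.
- by apply: inflection_non_ordinary => //; apply/infl; right.
Qed.
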